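(* Let $E$ be an arbitrary (countable, not necessarily row-finite) directed graph, $K$ a field and $u\in E^0$. Then $L_K(E)u$ is a minimal left ideal of $L_K(E)$ if and only if $u\in P_l(E)$.
   Context: A graph $E=(E^0,E^1,r,s)$ consists of countable sets $E^0$ (vertices), $E^1$ (edges) and maps $r,s:E^1\to E^0$ (range, source). A vertex $v$ is regular if $s^{-1}(v)$ is finite and nonempty. A path is a vertex (length $0$) or a sequence $\mu=e_1\cdots e_n$ of edges with $r(e_i)=s(e_{i+1})$; $s(\mu)=s(e_1)$, $r(\mu)=r(e_n)$. A cycle is a path $e_1\cdots e_n$ ($n\ge1$) with $s(e_1)=r(e_n)$ and $s(e_i)\neq s(e_j)$ for $i\ne j$. The Leavitt path algebra $L_K(E)$ is the $K$-algebra generated by a set $\{v: v\in E^0\}$ of pairwise orthogonal idempotents and elements $\{e,e^*: e\in E^1\}$ subject to: (1) $s(e)e=er(e)=e$; (2) $r(e)e^*=e^*s(e)=e^*$; (3) $e^*e'=\delta_{e,e'}r(e)$; (4) $v=\sum_{s(e)=v}ee^*$ for every regular vertex $v$. $T(v)$ is the set of vertices $w$ such that there is a path from $v$ to $w$ (length $0$ allowed). A vertex $v$ is a bifurcation if $|s^{-1}(v)|\ge 2$. A vertex $u$ is a line point if there are neither bifurcations nor cycles at any vertex $w\in T(u)$; $P_l(E)$ is the set of line points. A left ideal $I$ of an algebra $A$ is minimal if it is nonzero and the only left ideals of $A$ it contains are $0$ and $I$. *)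

(* Defs.v *)
From HB Require Import structures.
From mathcomp Require Import all_boot all_order all_algebra finmap.
From mathcomp Require Import boolp classical_sets functions cardinality.

Set Implicit Arguments.
Unset Strict Implicit.
Unset Printing Implicit Defensive.

Import GRing.Theory.
Local Open Scope classical_set_scope.
Local Open Scope ring_scope.
Local Open Scope quotient_scope.

(* Associative algebras without a unit: MathComp's [algType] requires one,
   whereas L_K(E) has a unit only when E^0 is finite. *)

HB.mixin Record Lmodule_isNuAlgebra (K : fieldType) A of GRing.Lmodule K A := {
  numul : A -> A -> A;
  numulA : associative numul;
  numulDl : left_distributive numul +%R;
  numulDr : right_distributive numul +%R;
  numulZl : forall (k : K) x y, numul (k *: x) y = k *: numul x y;
  numulZr : forall (k : K) x y, numul x (k *: y) = k *: numul x y
}.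

#[short(type="nuAlgType")]
HB.structure Definition NuAlgebra (K : fieldType) :=
  {A of Lmodule_isNuAlgebra K A & GRing.Lmodule K A}.

Notation "x ** y" := (numul x y) (at level 40, left associativity).

Section LeftIdeals.
Variables (K : fieldType) (A : nuAlgType K).

Definition left_ideal (I : set A) : Prop :=
  [/\ I 0,
      forall x y, I x -> I y -> I (x + y),
      forall (k : K) x, I x -> I (k *: x) &
      forall a x, I x -> I (a ** x)].

Definition minimal_left_ideal (I : set A) : Prop :=
  [/\ left_ideal I,
      I <> [set 0] &
      forall J : set A, left_ideal J -> J `<=` I -> J = [set 0] \/ J = I].

(* The set A x; without a unit, x itself need not belong to it. *)
Definition left_mult (x : A) : set A := [set a ** x | a in [set: A]].

End LeftIdeals.

Record graph := Graph {
  vertex : countType;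
  edge : countType;
  src : edge -> vertex;
  rng : edge -> vertex
}.

Section Graphs.
Variable E : graph.

Definition emitted (v : vertex E) : set (edge E) := [set e | src e = v].

Definition regular (v : vertex E) : Prop :=
  finite_set (emitted v) /\ emitted v !=set0.

(* Paths of positive length are nonempty sequences of composable edges, given
   here as a first edge and the list of the others; vertices, the paths of
   length 0, are treated separately in [reachable]. *)
Definition is_path (e : edge E) (p : seq (edge E)) : bool :=
  path [rel f g | rng f == src g] e p.

Definition path_source (e : edge E) (p : seq (edge E)) : vertex E := src e.
Definition path_range (e : edge E) (p : seq (edge E)) : vertex E :=
  rng (last e p).

Definition reachable (v : vertex E) : set (vertex E) :=
  [set w | v = w \/
     exists e p, [/\ is_path e p, path_source e p = v & path_range e p = w]].

Definition is_cycle (e : edge E) (p : seq (edge E)) : Prop :=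
  [/\ is_path e p, path_source e p = path_range e p & uniq (map (@src E) (e :: p))].

Definition cycle_at (v : vertex E) : Prop :=
  exists e p, is_cycle e p /\ path_source e p = v.

Definition bifurcation (v : vertex E) : Prop := (`I_2 #<= emitted v)%card.

Definition line_points : set (vertex E) :=
  [set u | forall w, reachable u w -> ~ bifurcation w /\ ~ cycle_at w].

End Graphs.

Arguments line_points : clear implicits.

(* L_K(E): nonunital algebra expressions in the generators v, e, e*, modulo the
   smallest congruence containing the axioms of associative K-algebras and the
   defining relations of the Leavitt path algebra (from [lc_vertex] on). *)
Section LeavittPathAlgebra.
Variables (K : fieldType) (E : graph).

Inductive lterm :=
| LVertex of vertex E
| LEdge of edge E
| LGhost of edge E
| LZero
| LAdd of lterm & lterm
| LOpp of lterm
| LScale of K & lterm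
| LMul of lterm & lterm.

Definition lsum (ts : seq lterm) : lterm := foldr LAdd LZero ts.

Inductive lcong : lterm -> lterm -> Prop :=
| lc_refl x : lcong x x
| lc_sym x y : lcong x y -> lcong y x
| lc_trans x y z : lcong x y -> lcong y z -> lcong x z
| lc_add x x' y y' : lcong x x' -> lcong y y' -> lcong (LAdd x y) (LAdd x' y')
| lc_opp x x' : lcong x x' -> lcong (LOpp x) (LOpp x')
| lc_scale k x x' : lcong x x' -> lcong (LScale k x) (LScale k x')
| lc_mul x x' y y' : lcong x x' -> lcong y y' -> lcong (LMul x y) (LMul x' y')
| lc_addA x y z : lcong (LAdd x (LAdd y z)) (LAdd (LAdd x y) z)
| lc_addC x y : lcong (LAdd x y) (LAdd y x)
| lc_add0 x : lcong (LAdd LZero x) x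
| lc_addN x : lcong (LAdd (LOpp x) x) LZero
| lc_scaleA k l x : lcong (LScale k (LScale l x)) (LScale (k * l) x)
| lc_scale1 x : lcong (LScale 1 x) x
| lc_scaleDr k x y : lcong (LScale k (LAdd x y)) (LAdd (LScale k x) (LScale k y))
| lc_scaleDl k l x : lcong (LScale (k + l) x) (LAdd (LScale k x) (LScale l x))
| lc_mulA x y z : lcong (LMul x (LMul y z)) (LMul (LMul x y) z)
| lc_mulDl x y z : lcong (LMul (LAdd x y) z) (LAdd (LMul x z) (LMul y z))
| lc_mulDr x y z : lcong (LMul x (LAdd y z)) (LAdd (LMul x y) (LMul x z))
| lc_mulZl k x y : lcong (LMul (LScale k x) y) (LScale k (LMul x y))
| lc_mulZr k x y : lcong (LMul x (LScale k y)) (LScale k (LMul x y))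
| lc_vertex v w :
    lcong (LMul (LVertex v) (LVertex w)) (if v == w then LVertex v else LZero)
| lc_src_edge e : lcong (LMul (LVertex (src e)) (LEdge e)) (LEdge e)
| lc_edge_rng e : lcong (LMul (LEdge e) (LVertex (rng e))) (LEdge e)
| lc_rng_ghost e : lcong (LMul (LVertex (rng e)) (LGhost e)) (LGhost e)
| lc_ghost_src e : lcong (LMul (LGhost e) (LVertex (src e))) (LGhost e)
| lc_ghost_edge e f :
    lcong (LMul (LGhost e) (LEdge f)) (if e == f then LVertex (rng e) else LZero)
| lc_regular v : regular v ->
    lcong (LVertex v)
          (lsum [seq LMul (LEdge e) (LGhost e) | e <- fset_set (emitted v)]).

HB.instance Definition _ := gen_eqMixin lterm.
HB.instance Definition _ := gen_choiceMixin lterm.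

Definition lcongb (x y : lterm) : bool := `[< lcong x y >].

Lemma lcongb_refl : reflexive lcongb.
Proof. by move=> x; apply/asboolP; exact: lc_refl. Qed.

Lemma lcongb_sym : symmetric lcongb.
Proof. by move=> x y; apply/asboolP/asboolP; exact: lc_sym. Qed.

Lemma lcongb_trans : transitive lcongb.
Proof.
move=> y x z /asboolP xy /asboolP yz; apply/asboolP; exact: lc_trans xy yz.
Qed.

Canonical lcongb_equiv := EquivRel lcongb lcongb_refl lcongb_sym lcongb_trans.

Definition leavitt : Type := {eq_quot lcongb}.

HB.instance Definition _ := Choice.on leavitt.
HB.instance Definition _ := EqQuotient.on leavitt.

Definition lclass (x : lterm) : leavitt := \pi_leavitt x.

Lemma lclassP x y : lclass x = lclass y <-> lcong x y.
Proof.
rewrite /lclass; split.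
  by move/eqP; rewrite (@eqmodE lterm lcongb_equiv) => /asboolP.
by move=> xy; apply/eqP; rewrite (@eqmodE lterm lcongb_equiv); apply/asboolP.
Qed.

Lemma lrepr_class x : lcong (repr (lclass x)) x.
Proof. by apply/lclassP; rewrite /lclass reprK. Qed.

Definition leavitt_zero : leavitt := lclass LZero.
Definition leavitt_add (a b : leavitt) := lclass (LAdd (repr a) (repr b)).
Definition leavitt_opp (a : leavitt) := lclass (LOpp (repr a)).
Definition leavitt_scale (k : K) (a : leavitt) := lclass (LScale k (repr a)).
Definition leavitt_mul (a b : leavitt) := lclass (LMul (repr a) (repr b)).

Lemma leavittW (P : leavitt -> Prop) : (forall x, P (lclass x)) -> forall a, P a.
Proof. by move=> Px a; rewrite -[a]reprK; exact: Px. Qed.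

Lemma leavitt_addE x y :
  leavitt_add (lclass x) (lclass y) = lclass (LAdd x y).
Proof. by apply/lclassP/lc_add; exact: lrepr_class. Qed.

Lemma leavitt_oppE x : leavitt_opp (lclass x) = lclass (LOpp x).
Proof. by apply/lclassP/lc_opp; exact: lrepr_class. Qed.

Lemma leavitt_scaleE k x : leavitt_scale k (lclass x) = lclass (LScale k x).
Proof. by apply/lclassP/lc_scale; exact: lrepr_class. Qed.

Lemma leavitt_mulE x y :
  leavitt_mul (lclass x) (lclass y) = lclass (LMul x y).
Proof. by apply/lclassP/lc_mul; exact: lrepr_class. Qed.

Let lE := (leavitt_addE, leavitt_oppE, leavitt_scaleE, leavitt_mulE).

Lemma leavitt_addA : associative leavitt_add.
Proof.
elim/leavittW=> x; elim/leavittW=> y; elim/leavittW=> z.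
by rewrite !lE; apply/lclassP/lc_addA.
Qed.

Lemma leavitt_addC : commutative leavitt_add.
Proof.
by elim/leavittW=> x; elim/leavittW=> y; rewrite !lE; apply/lclassP/lc_addC.
Qed.

Lemma leavitt_add0 : left_id leavitt_zero leavitt_add.
Proof. by elim/leavittW=> x; rewrite !lE; apply/lclassP/lc_add0. Qed.

Lemma leavitt_addN : left_inverse leavitt_zero leavitt_opp leavitt_add.
Proof. by elim/leavittW=> x; rewrite !lE; apply/lclassP/lc_addN. Qed.

HB.instance Definition _ := GRing.isZmodule.Build leavitt
  leavitt_addA leavitt_addC leavitt_add0 leavitt_addN.

Lemma lclassD x y : lclass (LAdd x y) = lclass x + lclass y.
Proof. by rewrite -leavitt_addE. Qed.

Lemma leavitt_scaleA k l a :
  leavitt_scale k (leavitt_scale l a) = leavitt_scale (k * l) a.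
Proof. by elim/leavittW: a => x; rewrite !lE; apply/lclassP/lc_scaleA. Qed.

Lemma leavitt_scale1 : left_id 1 leavitt_scale.
Proof. by elim/leavittW=> x; rewrite !lE; apply/lclassP/lc_scale1. Qed.

Lemma leavitt_scaleDr : right_distributive leavitt_scale +%R.
Proof.
move=> k; elim/leavittW=> x; elim/leavittW=> y.
by rewrite -lclassD !lE -lclassD; apply/lclassP/lc_scaleDr.
Qed.

Lemma leavitt_scaleDl a : {morph leavitt_scale^~ a : k l / k + l}.
Proof.
by move=> k l; elim/leavittW: a => x; rewrite !lE -lclassD; apply/lclassP/lc_scaleDl.
Qed.

HB.instance Definition _ := GRing.Zmodule_isLmodule.Build K leavitt
  leavitt_scaleA leavitt_scale1 leavitt_scaleDr leavitt_scaleDl.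

Lemma lclassZ k x : lclass (LScale k x) = k *: lclass x.
Proof. by rewrite -leavitt_scaleE. Qed.

Lemma leavitt_mulA : associative leavitt_mul.
Proof.
elim/leavittW=> x; elim/leavittW=> y; elim/leavittW=> z.
by rewrite !lE; apply/lclassP/lc_mulA.
Qed.

Lemma leavitt_mulDl : left_distributive leavitt_mul +%R.
Proof.
elim/leavittW=> x; elim/leavittW=> y; elim/leavittW=> z.
by rewrite -lclassD !lE -lclassD; apply/lclassP/lc_mulDl.
Qed.

Lemma leavitt_mulDr : right_distributive leavitt_mul +%R.
Proof.
elim/leavittW=> x; elim/leavittW=> y; elim/leavittW=> z.
by rewrite -lclassD !lE -lclassD; apply/lclassP/lc_mulDr.
Qed.

Lemma leavitt_mulZl (k : K) (a b : leavitt) :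
  leavitt_mul (k *: a) b = k *: leavitt_mul a b.
Proof.
elim/leavittW: a => x; elim/leavittW: b => y.
by rewrite -lclassZ !lE -lclassZ; apply/lclassP/lc_mulZl.
Qed.

Lemma leavitt_mulZr (k : K) (a b : leavitt) :
  leavitt_mul a (k *: b) = k *: leavitt_mul a b.
Proof.
elim/leavittW: a => x; elim/leavittW: b => y.
by rewrite -lclassZ !lE -lclassZ; apply/lclassP/lc_mulZr.
Qed.

HB.instance Definition _ := Lmodule_isNuAlgebra.Build K leavitt
  leavitt_mulA leavitt_mulDl leavitt_mulDr leavitt_mulZl leavitt_mulZr.

Definition lpa_vertex (v : vertex E) : leavitt := lclass (LVertex v).

End LeavittPathAlgebra.

(* Main.v *)
(** For a line point u every vertex x reached by a path b from u satisfies
    b b* = u and has no closed path, so an element of L u has the form c b*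
    with c a combination of paths ending at x, and a* c is a multiple of x for
    each path a ending at x. These multiples determine c, hence L u is generated
    by each of its nonzero elements.

    Conversely, if L u is minimal then the idempotent b b* generates it, whence
    b b* = u for every path b from u. Two edges e, f leaving the range of b would
    give u = (b e)(b e)* (b f)(b f)* = 0. If c is a closed path at x = r(b),
    necessarily without exits, then u - b c b* generates L u, which makes x a
    left multiple of x - c. This, as well as the vanishing of vertices and of
    x - c, is excluded by the action of L on functions on a branching system. *)
Require Import Defs.
From mathcomp Require Import all_boot all_algebra finmap.
From mathcomp Require Import boolp classical_sets functions cardinality.

Set Implicit Arguments.
Unset Strict Implicit.
Unset Printing Implicit Defensive.

Import GRing.Theory.
Local Open Scope classical_set_scope.
Local Open Scope ring_scope.

(** * Action of the Leavitt path algebra on functions on a branching system *)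

Section BranchingSystem.
Variables (K : fieldType) (E : graph).
Implicit Types (v w : vertex E) (e : edge E).

(* At each v that emits edges, phi restricts to a bijection from
   {e | src e = v} * nat onto nat, whose inverse is psi e for any such e. *)
Lemma branching_bijection : exists (phi : edge E -> nat -> nat)
    (psi : edge E -> nat -> edge E * nat),
  [/\ forall e f m, src e = src f -> psi f (phi e m) = (e, m),
      forall e n, src (psi e n).1 = src e &
      forall e n, phi (psi e n).1 (psi e n).2 = n].
Proof.
have nat_split v : emitted v !=set0 -> exists h : edge E * nat -> nat,
    {in [set x | src x.1 = v] &, injective h} /\
    forall n, exists2 x, src x.1 = v & h x = n.
  move=> [e0 ve0].
  (* The factor nat makes this countable set infinite even if [v] emits finitely many edges, so it
     is equipotent with nat. *)
  have /card_set_bijP[h [_ hinj hsurj]] :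
      (emitted v `*` [set: nat] #= [set: nat])%card.
    apply: eq_card_nat; first exact: countableP.
    move=> /(finite_image snd); apply: contra_not infinite_nat.
    by apply: sub_finite_set => n _; exists (e0, n).
  exists h; split=> [x y xv yv|n].
    by apply: hinj; rewrite inE /=; [move: xv|move: yv]; rewrite inE.
  by have [x [/= xv _] hx] := hsurj n I; exists x.
have /choice[h hP] v : exists h : edge E * nat -> nat, emitted v !=set0 ->
    {in [set x | src x.1 = v] &, injective h} /\
    forall n, exists2 x, src x.1 = v & h x = n.
  (* At a vertex emitting no edge the zero function is a mere default value. *)
  by have [/nat_split[h]|nv] := pselect (emitted v !=set0); [exists h|exists (fun=> 0%N)].
have he e : emitted (src e) !=set0 by exists e.
have /choice[psi psiP] (en : edge E * nat) :
    exists x, src x.1 = src en.1 /\ h (src en.1) x = en.2.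
  by have [x xs hx] := (hP _ (he en.1)).2 en.2; exists x.
exists (fun e m => h (src e) (e, m)), (fun e n => psi (e, n)); split=> [e f m ef|e n|e n].
- have [src_psi] := psiP (f, h (src e) (e, m)); rewrite /= -ef in src_psi *.
  by apply: (hP _ (he e)).1; rewrite inE /=.
- by have [] := psiP (e, n).
- by have [-> ] := psiP (e, n); rewrite -surjective_pairing.
Qed.

Definition branching_phi := projT1 (cid branching_bijection).
Definition branching_psi := projT1 (cid (projT2 (cid branching_bijection))).

Lemma branching_psiP :
  [/\ forall e f m, src e = src f -> branching_psi f (branching_phi e m) = (e, m),
      forall e n, src (branching_psi e n).1 = src e &
      forall e n, branching_phi (branching_psi e n).1 (branching_psi e n).2 = n].
Proof. exact: (projT2 (cid (projT2 (cid branching_bijection)))). Qed.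

Lemma branching_phiK e f m :
  src e = src f -> branching_psi f (branching_phi e m) = (e, m).
Proof. by have [+ _ _] := branching_psiP; exact. Qed.

Lemma src_branching_psi e n : src (branching_psi e n).1 = src e.
Proof. by have [_ + _] := branching_psiP; exact. Qed.

Lemma branching_psiK e n :
  branching_phi (branching_psi e n).1 (branching_psi e n).2 = n.
Proof. by have [_ _ +] := branching_psiP; exact. Qed.

(** Written as the [branching_phi] image of [branching_psi e n], the number [n] is sent back to that
    same pair by the inverse taken at [f]. *)
Lemma eq_branching_psi e f n : src e = src f -> branching_psi e n = branching_psi f n.
Proof.
move=> ef; rewrite -{2}[n](branching_psiK e) branching_phiK ?src_branching_psi //.
exact: surjective_pairing.
Qed.

(* The vertices are copies of nat, which the edges cut into copies of the ranges;
   the last component is a degree, shifted by each edge, so that a closed path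
   does not act as its base vertex. *)
Definition branching_pt : Type := (vertex E * nat * int)%type.

(** An edge carries functions on the copy of its range to functions on its piece of the copy of its
    source, extended by 0; its ghost carries them back. *)
Fixpoint lact (t : lterm K E) (f : branching_pt -> K^o) : branching_pt -> K^o :=
  match t with
  | LVertex v => fun x => if x.1.1 == v then f x else 0
  | LEdge e => fun x =>
      let y := branching_psi e x.1.2 in
      if (x.1.1 == src e) && (y.1 == e) then f (rng e, y.2, x.2 + 1) else 0
  | LGhost e => fun x =>
      if x.1.1 == rng e then f (src e, branching_phi e x.1.2, x.2 - 1) else 0
  | LZero => 0
  | LAdd s t => lact s f + lact t f
  | LOpp s => - lact s f
  | LScale k s => k *: lact s f
  | LMul s t => lact s (lact t f)
  end.

(** Products act by composition, so the axioms on sums and scalars in a right factor hold only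
    because each term acts linearly. *)
Lemma lact_linear t k f g : lact t (k *: f + g) = k *: lact t f + lact t g.
Proof.
elim: t f g => //=.
- by move=> v f g; apply/funext => x; rewrite !fctE; case: eqP => //; rewrite scaler0 addr0.
- by move=> v f g; apply/funext => x; rewrite !fctE; case: ifP => //; rewrite scaler0 addr0.
- by move=> v f g; apply/funext => x; rewrite !fctE; case: eqP => //; rewrite scaler0 addr0.
- by move=> f g; rewrite scaler0 addr0.
- by move=> s IHs t IHt f g; rewrite IHs IHt scalerDr addrACA.
- by move=> s IHs f g; rewrite IHs scalerN opprD.
- by move=> l s IHs f g; rewrite IHs scalerDr !scalerA mulrC.
- by move=> s IHs t IHt f g; rewrite IHt IHs.
Qed.

Lemma lactD t f g : lact t (f + g) = lact t f + lact t g.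
Proof. by rewrite -[f]scale1r lact_linear !scale1r. Qed.

Lemma lact0 t : lact t 0 = 0.
Proof. by apply: (@addrI _ (lact t 0)); rewrite -lactD !addr0. Qed.

Lemma lactZ t k f : lact t (k *: f) = k *: lact t f.
Proof. by rewrite -[k *: f]addr0 lact_linear lact0 addr0. Qed.

Lemma lact_lsum ts f : lact (lsum ts) f = \sum_(t <- ts) lact t f.
Proof. by elim: ts => [|t ts IH] /=; rewrite ?big_nil // big_cons IH. Qed.

(** The product [e e*] is the projection onto the piece of [e]; at a regular vertex these pieces
    partition the copy, which yields relation (4). *)
Lemma lact_edge_ghost e f x :
  lact (LMul (LEdge K e) (LGhost K e)) f x =
  if (x.1.1 == src e) && ((branching_psi e x.1.2).1 == e) then f x else 0.
Proof.
case: x => [[v n] d] /=; case: ifP => // /andP[/eqP -> /eqP psi_e].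
by rewrite eqxx /= -{2}psi_e branching_psiK addrK.
Qed.

Lemma lact_sound s t : lcong s t -> lact s = lact t.
Proof.
move=> st; apply/funext; elim: st => /=.
- by [].
- by move=> x y _ xy f; rewrite xy.
- by move=> x y z _ xy _ yz f; rewrite xy.
- by move=> x x' y y' _ xx _ yy f; rewrite xx yy.
- by move=> x x' _ xx f; rewrite xx.
- by move=> k x x' _ xx f; rewrite xx.
- by move=> x x' y y' _ xx _ yy f; rewrite xx yy.
- by move=> x y z f; rewrite addrA.
- by move=> x y f; rewrite addrC.
- by move=> x f; rewrite add0r.
- by move=> x f; rewrite addNr.
- by move=> k l x f; rewrite scalerA.
- by move=> x f; rewrite scale1r.
- by move=> k x y f; rewrite scalerDr.
- by move=> k l x f; rewrite scalerDl.
- by [].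
- by [].
- by move=> x y z f; rewrite lactD.
- by [].
- by move=> k x y f; rewrite lactZ.
- move=> v w f; apply/funext => x; case: (eqVneq v w) => [<-|vw] /=.
    by case: eqP.
  by case: eqP => // ->; rewrite (negPf vw).
- by move=> e f; apply/funext => x; case: eqP.
- by move=> e f; apply/funext => x; rewrite eqxx.
- by move=> e f; apply/funext => x; case: eqP.
- by move=> e f; apply/funext => x; rewrite eqxx.
- move=> e g f; apply/funext => -[[v n] d] /=; case: (eqVneq e g) => [<-|eg] /=.
    by case: eqP => // ->; rewrite eqxx branching_phiK //= eqxx subrK.
  by case: eqP => // _; case: eqP => //= ?; rewrite branching_phiK //= (negPf eg).
- move=> v [vfin [e0 ve0]] f; rewrite lact_lsum big_map; apply/funext => x.
  rewrite fct_sumE; under eq_bigr do rewrite lact_edge_ghost.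
  case: ifPn => [/eqP xv|xv].
    (* The edge whose piece contains [x]: its summand alone survives at [x]. *)
    set e := (branching_psi e0 x.1.2).1.
    have es : src e = v by rewrite src_branching_psi.
    have eS : e \in fset_set (emitted v) by rewrite in_fset_set // inE.
    have psi_e e' : src e' = v -> (branching_psi e' x.1.2).1 = e.
      by move=> e'v; rewrite /e (@eq_branching_psi e' e0) ?e'v.
    rewrite (big_fsetD1 e) //= xv es psi_e // !eqxx /=.
    rewrite big_seq big1 ?addr0 // => e'; rewrite in_fsetD1 in_fset_set //.
    move=> /andP[ee']; rewrite inE => /= e'v.
    by rewrite psi_e // [e == e']eq_sym (negPf ee') andbF.
  rewrite big_seq big1 // => e'; rewrite in_fset_set // inE => /= ->.
  by rewrite (negPf xv).
Qed.

Definition leavitt_act (a : leavitt K E) := lact (repr a).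

Lemma leavitt_act_class t : leavitt_act (lclass t) = lact t.
Proof. exact/lact_sound/lrepr_class. Qed.

Lemma leavitt_actM a b f : leavitt_act (a ** b) f = leavitt_act a (leavitt_act b f).
Proof. by rewrite [_ ** _]/(leavitt_mul a b) leavitt_act_class. Qed.

Lemma leavitt_actD a b f : leavitt_act (a + b) f = leavitt_act a f + leavitt_act b f.
Proof. by rewrite [a + b]/(leavitt_add a b) leavitt_act_class. Qed.

Lemma leavitt_actN a f : leavitt_act (- a) f = - leavitt_act a f.
Proof. by rewrite [- a]/(leavitt_opp a) leavitt_act_class. Qed.

Lemma leavitt_act0 f : leavitt_act 0 f = 0.
Proof. by rewrite [0]/(leavitt_zero K E) leavitt_act_class. Qed.

End BranchingSystem.

(** * Nonunital algebras and their principal left ideals *)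

Section NuAlgebraTheory.
Variables (K : fieldType) (A : nuAlgType K).
Implicit Types (x y z : A).

Lemma numul0l x : 0 ** x = 0.
Proof. by apply: (@addrI _ (0 ** x)); rewrite -numulDl !addr0. Qed.

Lemma numul0r x : x ** 0 = 0.
Proof. by apply: (@addrI _ (x ** 0)); rewrite -numulDr !addr0. Qed.

Lemma numulNl x y : (- x) ** y = - (x ** y).
Proof. by apply: (@addIr _ (x ** y)); rewrite -numulDl !addNr numul0l. Qed.

Lemma numulNr x y : x ** (- y) = - (x ** y).
Proof. by apply: (@addIr _ (x ** y)); rewrite -numulDr !addNr numul0r. Qed.

Lemma numul_suml I (r : seq I) (F : I -> A) y :
  (\sum_(i <- r) F i) ** y = \sum_(i <- r) F i ** y.
Proof. by apply: (big_morph (fun x => x ** y)) => [a b|]; rewrite ?numulDl ?numul0l. Qed.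

Lemma numul_sumr I (r : seq I) (F : I -> A) x :
  x ** (\sum_(i <- r) F i) = \sum_(i <- r) x ** F i.
Proof. by apply: (big_morph (fun y => x ** y)) => [a b|]; rewrite ?numulDr ?numul0r. Qed.

Lemma left_mult_ideal x : left_ideal (left_mult x).
Proof.
split=> [|_ _ [a _ <-] [b _ <-]|k _ [a _ <-]|b _ [a _ <-]].
- by exists 0; rewrite ?numul0l.
- by exists (a + b); rewrite ?numulDl.
- by exists (k *: a); rewrite ?numulZl.
- by exists (b ** a); rewrite -?numulA.
Qed.

Lemma left_mult_sub (I : set A) x : left_ideal I -> I x -> left_mult x `<=` I.
Proof. by move=> [_ _ _ I_mul] Ix _ [a _ <-]; exact: I_mul. Qed.

End NuAlgebraTheory.

(** * Paths, cycles and line points *)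

Section Walks.
Variable E : graph.
Implicit Types (u v w : vertex E) (e f : edge E) (p q : seq (edge E)).

(* A path is encoded by its range w and its edges p, so that [::] stands for
   the vertex w; [walk w p] says that the edges are composable and lead to w. *)
Definition start w p := head w (map (@src E) p).

Fixpoint walk w p : bool :=
  if p is e :: q then (rng e == start w q) && walk w q else true.

Lemma start_cat w p q : start w (p ++ q) = start (start w q) p.
Proof. by case: p. Qed.

Lemma walk_cat w p q : walk w (p ++ q) = walk (start w q) p && walk w q.
Proof. by elim: p => //= e p ->; rewrite start_cat andbA. Qed.

Lemma walk_cons w e p : walk w (e :: p) = is_path e p && (rng (last e p) == w).
Proof.
elim: p e => [|f p IH] e; first by rewrite /= andbT.
by rewrite -[LHS]/((rng e == src f) && walk w (f :: p)) IH /= andbA.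
Qed.

Lemma reachableP v w : reachable v w <-> exists2 p, walk w p & start w p = v.
Proof.
split=> [[->|[e [p [ep <- <-]]]]|[[|e p]]].
- by exists [::].
- by exists (e :: p) => //; rewrite walk_cons ep eqxx.
- by move=> _ <-; left.
- by rewrite walk_cons => /andP[ep /eqP <-] <-; right; exists e, p.
Qed.

(** A shortest closed path is a cycle: if two edges share their source, cutting out the segment
    between them leaves a shorter closed path at the same vertex. *)
Lemma cycle_atP v :
  cycle_at v <-> exists p, [/\ p != [::], walk v p & start v p = v].
Proof.
split=> [[e [p [[ep cyc _] <-]]]|[p]].
  by exists (e :: p); split=> //; rewrite walk_cons ep -[rng _]/(path_range e p) cyc eqxx.
have [n] := ubnP (size p); elim: n p => // n IH p pn [p0 vp sp].
have [pu|/(uniqPn v)[i [j [ij jp eqij]]]] := boolP (uniq (map (@src E) p)).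
  case: p p0 vp sp pu {pn} => // e p _; rewrite walk_cons => /andP[ep /eqP lp] sp pu.
  by exists e, p; split=> //; split=> //; rewrite /path_range lp.
rewrite size_map in jp.
have start_drop k : (k < size p)%N -> start v (drop k p) = nth v (map (@src E) p) k.
  by move=> kp; rewrite /start -nth0 map_drop nth_drop addn0.
have ip := ltn_trans ij jp.
(* The edge at position [j] is kept, so the shortened path is nonempty and still starts at [v], even
   when [i] is 0. *)
apply: (IH (take i p ++ drop j p)).
  rewrite size_cat size_take ip size_drop -ltnS (leq_trans _ pn) // ltnS.
  by rewrite -[ltnRHS](subnKC (ltnW jp)) ltn_add2r.
have sij : start v (drop j p) = start v (drop i p) by rewrite !start_drop.
have := vp; rewrite -{1}[p](cat_take_drop i) walk_cat => /andP[vt _].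
have := vp; rewrite -{1}[p](cat_take_drop j) walk_cat => /andP[_ vd].
split; last 2 first.
- by rewrite walk_cat sij vt vd.
- by rewrite start_cat sij -start_cat cat_take_drop.
- by rewrite -size_eq0 size_cat size_drop addn_eq0 subn_eq0 leqNgt jp andbF.
Qed.

Lemma bifurcationP v :
  bifurcation v <-> exists e f, [/\ src e = v, src f = v & e != f].
Proof.
split.
  move=> /card_leP[f].
  have i0 : (0 : nat) \in `I_2 by rewrite inE.
  have i1 : 1%N \in `I_2 by rewrite inE.
  exists (val (f (SigSub i0))), (val (f (SigSub i1))).
  split; [apply: (set_valP (f _))|apply: (set_valP (f _))|].
  by apply/eqP => /val_inj /(inj (mem_set I) (mem_set I)) /(congr1 val).
move=> [e [f [ev fv ef]]].
pose h n := if n is 0%N then e else f.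
have h_inj : {in `I_2 &, injective h}.
  move=> [|[|m]] [|[|n]]; rewrite !inE //= => _ _ /eqP; rewrite ?(negPf ef) //.
  by rewrite eq_sym (negPf ef).
rewrite /bifurcation -(card_le_eql (inj_card_eq h_inj)).
by apply: subset_card_le => _ [[|n] _ <-].
Qed.

Lemma line_points_src u e f : line_points E u -> src e = u -> src f = u -> e = f.
Proof.
move=> /(_ u)[|nbif _ eu fu]; first by left.
by apply/eqP/negPn/negP => ef; apply/nbif/bifurcationP; exists e, f.
Qed.

Lemma line_points_walk w p :
  line_points E (start w p) -> walk w p -> line_points E w.
Proof.
move=> up wp x /reachableP[q xq sq]; apply: up; apply/reachableP.
by exists (p ++ q); rewrite ?walk_cat ?start_cat sq ?xq ?wp.
Qed.

Lemma line_points_rng e : line_points E (src e) -> line_points E (rng e).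
Proof. by move=> ue; apply: (@line_points_walk _ [:: e]) => //=; rewrite eqxx. Qed.

Lemma line_points_acyclic w p :
  line_points E w -> walk w p -> start w p = w -> p = [::].
Proof.
move=> /(_ w)[|_ nc wp sp]; first by left.
by apply/eqP/negPn/negP => p0; apply/nc/cycle_atP; exists p.
Qed.

(** Along a line there is never a choice of next edge, so two paths with the same start agree until
    one of them stops. *)
Lemma line_points_prefix w x p q :
  line_points E (start w p) -> walk w p -> walk x q -> start x q = start w p ->
  (exists r, [/\ q = p ++ r, walk x r & start x r = w]) \/
  (exists r, [/\ p = q ++ r, walk w r & start w r = x]).
Proof.
elim: p q => [|e p IH] [|f q].
- by move=> _ _ _ /esym wx; left; exists [::].
- by move=> _ _ xq fw; left; exists (f :: q).
- by move=> _ wp _ /esym xe; right; exists (e :: p).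
move=> ue /= /andP[/eqP ep wp] /andP[/eqP fq xq] /= fe.
rewrite /= in ue.
have ef : f = e by apply: line_points_src ue _ _.
rewrite {}ef {f fe} in fq *.
have := line_points_rng ue; rewrite ep => lp.
have [|[r [-> xr rw]]|[r [-> wr rx]]] := IH q lp wp xq; first by rewrite -fq.
  by left; exists r.
by right; exists r.
Qed.

End Walks.

(** * Products of paths and ghost paths *)

Section Monomials.
Variables (K : fieldType) (E : graph).
Implicit Types (u v w : vertex E) (e f : edge E) (p q r : seq (edge E)).

Local Notation L := (leavitt K E).
Local Notation V := (lpa_vertex K).

Definition lpa_edge e : L := lclass (LEdge K e).
Definition lpa_ghost e : L := lclass (LGhost K e).

Lemma eq_lclass (s t : lterm K E) : lcong s t -> lclass s = lclass t.
Proof. exact: (lclassP s t).2. Qed.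

Lemma lclassM (s t : lterm K E) : lclass (LMul s t) = lclass s ** lclass t.
Proof. by rewrite -leavitt_mulE. Qed.

Lemma lclassN (s : lterm K E) : lclass (LOpp s) = - lclass s.
Proof. by rewrite -leavitt_oppE. Qed.

Lemma lclass_lsum (ts : seq (lterm K E)) : lclass (lsum ts) = \sum_(t <- ts) lclass t.
Proof. by elim: ts => [|t ts IH]; rewrite ?big_nil // big_cons -IH -lclassD. Qed.

Lemma lpa_vertexM v w : V v ** V w = if v == w then V v else 0.
Proof.
by rewrite -lclassM; rewrite (eq_lclass (lc_vertex K v w)); case: ifP.
Qed.

Lemma lpa_vertex_edge v e : V v ** lpa_edge e = if src e == v then lpa_edge e else 0.
Proof.
have se : V (src e) ** lpa_edge e = lpa_edge e.
  by rewrite -lclassM; apply/eq_lclass/lc_src_edge.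
by rewrite -se numulA lpa_vertexM eq_sym; case: eqP => [->|] //; rewrite numul0l.
Qed.

Lemma lpa_edge_vertex e : lpa_edge e ** V (rng e) = lpa_edge e.
Proof. by rewrite -lclassM; apply/eq_lclass/lc_edge_rng. Qed.

Lemma lpa_vertex_ghost e : V (rng e) ** lpa_ghost e = lpa_ghost e.
Proof. by rewrite -lclassM; apply/eq_lclass/lc_rng_ghost. Qed.

Lemma lpa_ghost_vertex v e : lpa_ghost e ** V v = if src e == v then lpa_ghost e else 0.
Proof.
have es : lpa_ghost e ** V (src e) = lpa_ghost e.
  by rewrite -lclassM; apply/eq_lclass/lc_ghost_src.
by rewrite -es -numulA lpa_vertexM; case: eqP => // _; rewrite numul0r.
Qed.

Lemma lpa_ghost_edge e f : lpa_ghost e ** lpa_edge f = if e == f then V (rng e) else 0.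
Proof.
by rewrite -lclassM; rewrite (eq_lclass (lc_ghost_edge K e f)); case: ifP.
Qed.

(** The source of such an edge is regular, and relation (4) there has a single summand. *)
Lemma lpa_edge_ghost e :
  (forall f, src f = src e -> f = e) -> lpa_edge e ** lpa_ghost e = V (src e).
Proof.
move=> e_only; have emE : emitted (src e) = [set e].
  by apply/seteqP; split=> [f /e_only|_ ->].
have /(lc_regular K)/eq_lclass : regular (src e).
  by rewrite /regular emE; split; [exact: finite_set1|exists e].
by rewrite lclass_lsum big_map emE fset_set1 big_seq_fset1 lclassM => <-.
Qed.

(* [rpath w p] is the path p with range w and [gpath w p] is its ghost; they
   vanish when the edges of p do not form such a path. *)
Definition rpath w p : L := foldr (fun e x => lpa_edge e ** x) (V w) p.
Definition gpath w p : L := foldr (fun e x => x ** lpa_ghost e) (V w) p.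

Lemma lpa_vertex_rpath v w p : V v ** rpath w p = if start w p == v then rpath w p else 0.
Proof.
case: p => [|e p] /=; first by rewrite lpa_vertexM eq_sym; case: eqP => [->|].
by rewrite numulA lpa_vertex_edge; case: ifP => //; rewrite numul0l.
Qed.

Lemma gpath_lpa_vertex v w p : gpath w p ** V v = if start w p == v then gpath w p else 0.
Proof.
case: p => [|e p] /=; first by rewrite lpa_vertexM.
by rewrite -numulA lpa_ghost_vertex; case: ifP => //; rewrite numul0r.
Qed.

Lemma rpath_lpa_vertex w p : rpath w p ** V w = rpath w p.
Proof. by elim: p => [|e p IH] /=; rewrite ?lpa_vertexM ?eqxx // -numulA IH. Qed.

Lemma lpa_vertex_gpath w p : V w ** gpath w p = gpath w p.
Proof. by elim: p => [|e p IH] /=; rewrite ?lpa_vertexM ?eqxx // numulA IH. Qed.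

Lemma rpath_cat w p q : rpath w (p ++ q) = rpath (start w q) p ** rpath w q.
Proof.
by elim: p => [|e p IH] /=; rewrite ?lpa_vertex_rpath ?eqxx // IH numulA.
Qed.

Lemma gpath_cat w p q : gpath w (p ++ q) = gpath w q ** gpath (start w q) p.
Proof.
by elim: p => [|e p IH] /=; rewrite ?gpath_lpa_vertex ?eqxx // IH numulA.
Qed.

(** At a break, inserting the range of the edge before it creates a product of two distinct
    vertices, which is 0. *)
Lemma rpath_eq0 w p : ~~ walk w p -> rpath w p = 0.
Proof.
elim: p => //= e p IH; rewrite negb_and => /orP[|/IH ->]; last by rewrite numul0r.
rewrite eq_sym => /negPf ep.
by rewrite -lpa_edge_vertex -numulA lpa_vertex_rpath ep numul0r.
Qed.

Lemma gpath_eq0 w p : ~~ walk w p -> gpath w p = 0.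
Proof.
elim: p => //= e p IH; rewrite negb_and => /orP[|/IH ->]; last by rewrite numul0l.
rewrite eq_sym => /negPf ep.
by rewrite -lpa_vertex_ghost numulA gpath_lpa_vertex ep numul0l.
Qed.

Lemma gpath_rpath w p : walk w p -> gpath w p ** rpath w p = V w.
Proof.
elim: p => [|e p IH] /=; first by rewrite lpa_vertexM eqxx.
move=> /andP[/eqP ep /IH <-]; rewrite numulA -[_ ** lpa_ghost e ** _]numulA.
by rewrite lpa_ghost_edge eqxx gpath_lpa_vertex ep eqxx.
Qed.

(** Every edge of the path is the only one leaving its source, so the product collapses from the
    middle outwards by [e e* = s(e)]. *)
Lemma rpath_gpath w p : line_points E (start w p) -> walk w p ->
  rpath w p ** gpath w p = V (start w p).
Proof.
elim: p => [|e p IH] /=; first by rewrite lpa_vertexM eqxx.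
move=> le /andP[/eqP ep wp]; rewrite -numulA [rpath w p ** _]numulA IH //; last first.
  by rewrite -ep; exact: line_points_rng.
rewrite -ep lpa_vertex_ghost lpa_edge_ghost // => f fe.
exact: line_points_src le fe _.
Qed.

(** Common initial edges cancel. At a first difference [e* f = 0]; if one path ends first, what is
    left of the other would be a closed path at [w], which a line point excludes. *)
Lemma gpath_rpath_line w p q : line_points E w ->
  gpath w p ** rpath w q = if (p == q) && walk w p then V w else 0.
Proof.
move=> lw; case: eqVneq => [<-|] /=.
  by case: ifPn => [/gpath_rpath|/rpath_eq0 ->] //; rewrite numul0r.
elim: p q => [|e p IH] [|f q] // pq.
- rewrite -[gpath w [::]]/(V w) lpa_vertex_rpath; case: eqP => // fw.
  by apply: rpath_eq0; apply/negP => /(line_points_acyclic lw)/(_ fw).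
- rewrite -[rpath w [::]]/(V w) gpath_lpa_vertex; case: eqP => // ew.
  have ep : ~~ walk w (e :: p).
    by apply/negP => /(line_points_acyclic lw)/(_ ew).
  exact: gpath_eq0.
- rewrite /= numulA -[_ ** lpa_ghost e ** _]numulA lpa_ghost_edge.
  case: (eqVneq e f) pq => [<-|_ _]; last by rewrite numul0r numul0l.
  rewrite eqseq_cons eqxx /= => pq.
  rewrite -numulA lpa_vertex_rpath; case: eqP => _; last by rewrite numul0r.
  exact: IH.
Qed.

End Monomials.

Section MinimalIdeals.
Variables (K : fieldType) (E : graph).
Implicit Types (u v w : vertex E) (e f : edge E) (p q r : seq (edge E)).
Implicit Types (s : seq (K * seq (edge E))).

Local Notation L := (leavitt K E).
Local Notation V := (lpa_vertex K).
Local Notation rpath := (rpath K).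
Local Notation gpath := (gpath K).

(** * Normal form of the elements of L u at a line point u *)

Definition rcomb w s : L := \sum_(x <- s) x.1 *: rpath w x.2.

Lemma rcomb_cat w s t : rcomb w (s ++ t) = rcomb w s + rcomb w t.
Proof. exact: big_cat. Qed.

Lemma rcomb_scale k w s : rcomb w [seq (k * x.1, x.2) | x <- s] = k *: rcomb w s.
Proof.
by rewrite /rcomb big_map scaler_sumr; apply: eq_bigr => x _; rewrite scalerA.
Qed.

Lemma rcomb0 w : rcomb w [::] = 0.
Proof. exact: big_nil. Qed.

Lemma rcomb1 w p : rcomb w [:: (1, p)] = rpath w p.
Proof. by rewrite /rcomb big_seq1 scale1r. Qed.

Lemma rcomb_mul w s (a : L) :
  (forall x, x \in s -> exists t, a ** rpath w x.2 = rcomb w t) ->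
  exists t, a ** rcomb w s = rcomb w t.
Proof.
move=> sP; rewrite /rcomb numul_sumr big_seq -/(rcomb w _).
apply: (big_ind (fun x => exists t, x = rcomb w t)).
- by exists [::]; rewrite rcomb0.
- by move=> _ _ [t ->] [t' ->]; exists (t ++ t'); rewrite rcomb_cat.
move=> x /sP[t at_]; exists [seq (x.1 * y.1, y.2) | y <- t].
by rewrite numulZr at_ rcomb_scale.
Qed.

Lemma rcomb_extend w x s r : walk x r -> start x r = w ->
  rcomb x [seq (y.1, y.2 ++ r) | y <- s] = rcomb w s ** rpath x r.
Proof.
move=> xr <-; rewrite /rcomb big_map numul_suml; apply: eq_bigr => y _.
by rewrite numulZl rpath_cat.
Qed.

Lemma gpath_rcomb w p s : line_points E w -> exists k, gpath w p ** rcomb w s = k *: V w.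
Proof.
move=> lw; rewrite /rcomb numul_sumr; apply: (big_ind (fun x => exists k, x = k *: V w)).
- by exists 0; rewrite scale0r.
- by move=> _ _ [k ->] [l ->]; exists (k + l); rewrite scalerDl.
move=> x _; rewrite numulZr gpath_rpath_line //; case: ifP => _; first by exists x.1.
by exists 0; rewrite scaler0 scale0r.
Qed.

(** By orthogonality of the paths ending at [w], the sum of the [p p*] over the paths that occur
    fixes the combination, which is thus recovered from the products [p* c]. *)
Lemma rcomb_eq0 w s : line_points E w ->
  (forall p, gpath w p ** rcomb w s = 0) -> rcomb w s = 0.
Proof.
move=> lw gs0.
(* A path may occur several times in [s]; it must enter the sum of the [p p*] only once. *)
pose ps := undup (map snd s).
have -> : rcomb w s = \sum_(p <- ps) rpath w p ** (gpath w p ** rcomb w s).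
  under eq_bigr do rewrite /rcomb numul_sumr numul_sumr.
  rewrite exchange_big /rcomb; apply: eq_big_seq => x xs.
  have xps : x.2 \in ps by rewrite mem_undup map_f.
  rewrite (bigD1_seq x.2) ?undup_uniq //= big1 => [|p px].
    rewrite addr0 !numulZr gpath_rpath_line // eqxx /=.
    by case: ifPn => [_|/rpath_eq0 ->]; rewrite ?rpath_lpa_vertex // numul0r.
  by rewrite numulZr gpath_rpath_line // (negPf px) scaler0 numul0r.
by rewrite big1 // => p _; rewrite gs0 numul0r.
Qed.

Definition line_form u (x : L) := exists w p s,
  [/\ walk w p, start w p = u & x = rcomb w s ** gpath w p].

(** On a line [r r* = w] may be inserted between the combination and the ghost path, as one expands
    a fraction. *)
Lemma line_form_extend u w p s x r : line_points E u ->
  walk w p -> start w p = u -> walk x r -> start x r = w ->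
  rcomb w s ** gpath w p =
  rcomb x [seq (y.1, y.2 ++ r) | y <- s] ** gpath x (p ++ r).
Proof.
move=> lu wp su xr sr.
rewrite (@rcomb_extend w) // gpath_cat sr numulA -[_ ** rpath x r ** _]numulA.
rewrite rpath_gpath // sr; last by rewrite -su in lu; exact: line_points_walk lu wp.
by rewrite -numulA lpa_vertex_gpath.
Qed.

Lemma line_formZ u k x : line_form u x -> line_form u (k *: x).
Proof.
move=> [w [p [s [wp su ->]]]]; exists w, p, [seq (k * y.1, y.2) | y <- s].
by rewrite rcomb_scale numulZl.
Qed.

(** Of two paths starting at [u] one extends the other, so both elements can be brought to the
    longer ghost path. *)
Lemma line_formD u x y : line_points E u ->
  line_form u x -> line_form u y -> line_form u (x + y).
Proof.
move=> lu [w [p [s [wp su ->]]]] [w' [q [t [wq su' ->]]]].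
have lup : line_points E (start w p) by rewrite su.
have [|[r [qE wr sr]]|[r [pE wr sr]]] := line_points_prefix lup wp wq; first by rewrite su.
  rewrite (line_form_extend s lu wp su wr sr) -qE -numulDl -rcomb_cat.
  by exists w', q; eexists.
rewrite (line_form_extend t lu wq su' wr sr) -pE -numulDl -rcomb_cat.
by exists w, p; eexists.
Qed.

Lemma line_form_mul u a x : line_points E u -> line_form u x -> line_form u (a ** x).
Proof.
move=> lu; elim/leavittW: a => t.
elim: t x => [v|e|e||t IHt t' IHt'|t IHt|k t IHt|t IHt t' IHt'] x xu.
- have [w [p [s [wp su ->]]]] := xu.
  have [|t vs] := @rcomb_mul w s (V v); last by exists w, p, t; rewrite numulA vs.
  move=> y _; rewrite lpa_vertex_rpath; case: ifP => _.
    by eexists; rewrite -rcomb1.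
  by exists [::]; rewrite rcomb0.
- have [w [p [s [wp su ->]]]] := xu.
  have [|t es] := @rcomb_mul w s (lpa_edge K e); last by exists w, p, t; rewrite numulA es.
  by move=> y _; exists [:: (1, e :: y.2)]; rewrite rcomb1.
(* A ghost [e*] removes a first edge or gives 0, except on the path of length 0 at [w = src e],
   where [e* w = e*] is not a combination of paths. *)
- have ghost_form w p s : walk w p -> start w p = u ->
      (forall y, y \in s -> y.2 = [::] -> src e <> w) ->
      line_form u (lpa_ghost K e ** (rcomb w s ** gpath w p)).
    move=> wp su sP; have [|t es] := @rcomb_mul w s (lpa_ghost K e).
      move=> [k [|f q]] /= ys.
        exists [::]; rewrite rcomb0 lpa_ghost_vertex; case: eqP => // ew.
        by case: (sP _ ys).
      rewrite numulA lpa_ghost_edge; case: eqP => _; last first.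
        by exists [::]; rewrite rcomb0 numul0l.
      rewrite lpa_vertex_rpath; case: ifP => _; last by exists [::]; rewrite rcomb0.
      by exists [:: (1, q)]; rewrite rcomb1.
    by exists w, p, t; rewrite numulA es.
  have [w [p [s [wp su ->]]]] := xu.
  have [ew|ew] := eqVneq (src e) w; last by apply: ghost_form => // y _ _; apply/eqP.
  (* Extending by [e] itself makes every path of the combination nonempty, which removes the
     exception. *)
  have wr : walk (rng e) [:: e] by rewrite /= eqxx.
  rewrite (line_form_extend s lu wp su wr ew); apply: ghost_form.
  + by rewrite walk_cat wr [start _ [:: e]]ew wp.
  + by rewrite start_cat [start _ [:: e]]ew.
  + by move=> _ /mapP[y _ ->] /=; case: y.2.
- by rewrite numul0l; exists u, [::], [::]; rewrite rcomb0 numul0l.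
- by rewrite lclassD numulDl; apply: line_formD; [|exact: IHt|exact: IHt'].
- by rewrite lclassN numulNl -scaleN1r; apply/line_formZ/IHt.
- by rewrite lclassZ numulZl; apply/line_formZ/IHt.
- by rewrite lclassM -numulA; apply/IHt/IHt'.
Qed.

(** Write [x = c b*] and choose a path [q] with [q* c = k w], where [k] is nonzero; then [k^-1 b q*]
    sends [x] to [b b* = u]. *)
Lemma line_point_generator u x : line_points E u -> x != 0 -> left_mult (V u) x ->
  exists a, a ** x = V u.
Proof.
move=> lu + [b _ bux]; have : line_form u (V u).
  exists u, [::], [:: (1, [::])]; split=> //.
  by rewrite /rcomb big_seq1 /= scale1r lpa_vertexM eqxx.
move=> /(line_form_mul b lu); rewrite bux => -[w [p [s [wp su ->]]]] {x bux} x0.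
have lw : line_points E w by rewrite -su in lu; exact: line_points_walk lu wp.
have [q gq0] : exists q, gpath w q ** rcomb w s != 0.
  apply: contrapT => gs0; move/eqP: x0; apply.
  rewrite rcomb_eq0 ?numul0l // => q; apply/eqP/negPn/negP => gq0.
  by apply: gs0; exists q.
have [k gk] := gpath_rcomb q s lw.
have k0 : k != 0 by apply: contraNneq gq0 => k0; rewrite gk k0 scale0r.
exists (k^-1 *: (rpath w p ** gpath w q)).
rewrite numulZl numulA -[_ ** gpath w q ** _]numulA gk numulZr numulZl scalerA mulVf //.
by rewrite scale1r rpath_lpa_vertex rpath_gpath // su.
Qed.

(** * Consequences of the minimality of L u *)

Lemma lpa_vertex_neq0 u : V u != 0.
Proof.
apply/eqP => u0; have := leavitt_act_class (LVertex K u).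
rewrite -/(V u) u0 => /(congr1 (fun F => F (fun=> 1) (u, 0%N, 0))) /=.
by rewrite leavitt_act0 eqxx => /esym/eqP; rewrite oner_eq0.
Qed.

Lemma left_mult_vertex u : left_mult (V u) (V u).
Proof. by exists (V u); rewrite ?lpa_vertexM ?eqxx. Qed.

(** Minimality applies to the ideal L x, in which [x] itself need not lie; the element [V u ** x]
    shows that it is nonzero. *)
Lemma minimal_generator u (x : L) : minimal_left_ideal (left_mult (V u)) ->
  left_mult (V u) x -> V u ** x != 0 -> exists a, V u = a ** x.
Proof.
move=> [uI _ umin] ux ux0.
have [xE|xE] := umin _ (left_mult_ideal x) (left_mult_sub uI ux).
  by move/eqP: ux0; case; have : left_mult x (V u ** x) by [exists (V u)]; rewrite xE.
by have : left_mult x (V u); [rewrite xE; exact: left_mult_vertex|case=> a _ <-; exists a].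
Qed.

(** The element [x = p p*] is idempotent with [u x = x]. Minimality gives [u = a x], so
    [x = u x = a x x = a x = u]. *)
Lemma minimal_path u w p : minimal_left_ideal (left_mult (V u)) ->
  walk w p -> start w p = u -> rpath w p ** gpath w p = V u.
Proof.
move=> umin wp su; set x := rpath w p ** gpath w p.
have xx : x ** x = x.
  by rewrite /x numulA -[_ ** gpath w p ** _]numulA gpath_rpath // rpath_lpa_vertex.
have ux : V u ** x = x by rewrite numulA lpa_vertex_rpath su eqxx.
have xu : x ** V u = x by rewrite -numulA gpath_lpa_vertex su eqxx.
have x0 : x != 0.
  (* Indeed [p* x p = w] is nonzero. *)
  apply: contraNneq (lpa_vertex_neq0 w) => x0.
  rewrite -(gpath_rpath K wp) -{1}(rpath_lpa_vertex K w p) -(gpath_rpath K wp).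
  by rewrite [_ ** (gpath _ _ ** _)]numulA -/x x0 numul0l numul0r eqxx.
have [a ua] : exists a, V u = a ** x.
  by apply: minimal_generator => //; [exists x|rewrite ux].
by rewrite -ux ua -numulA xx.
Qed.

Definition no_exits p := forall e f, e \in p -> src f = src e -> f = e.

(** Without exits, the piece of each edge is the whole copy of its source, so on functions of the
    degree alone each edge acts as a shift by 1. *)
Lemma leavitt_act_rpath w p (g : int -> K) : no_exits p -> walk w p ->
  leavitt_act (rpath w p) (fun x => g x.2) =
  fun x => if x.1.1 == start w p then g (x.2 + (size p)%:Z) else 0.
Proof.
elim: p => [|e p IH] ne wp.
  by rewrite leavitt_act_class; apply/funext => x /=; rewrite addr0.
case/andP: wp => /eqP ep wp; rewrite leavitt_actM IH //; last first.
  by move=> e' f e'p; apply: ne; rewrite inE e'p orbT.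
rewrite leavitt_act_class; apply/funext => x /=; rewrite ep eqxx.
case: eqP => //= _; rewrite (ne _ _ (mem_head _ _) (src_branching_psi e _)) eqxx.
by rewrite -addrA -intS.
Qed.

(* The path p raises the degree, hence differs from w on the indicator function
   of degree 0. *)
Lemma closed_path_neq w p : p != [::] -> no_exits p -> walk w p ->
  V w - rpath w p != 0.
Proof.
move=> p0 ne wp; apply/eqP => wp0.
have := leavitt_act0 (fun x : branching_pt E => (x.2 == 0)%:R : K^o).
rewrite -wp0 leavitt_actD leavitt_actN leavitt_act_class.
rewrite (leavitt_act_rpath (fun d => (d == 0)%:R)) //.
move=> /(congr1 (fun F => F (w, 0%N, 0))); rewrite !fctE /= eqxx.
rewrite add0r eqz_nat size_eq0 (negPf p0) if_same subr0 => /eqP.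
by rewrite oner_eq0.
Qed.

(* The constant function 1 is killed by w - p but not by w. *)
Lemma closed_path_not_inv w p (b : L) : no_exits p -> walk w p -> start w p = w ->
  V w <> b ** (V w - rpath w p).
Proof.
move=> ne wp sp wE.
have : leavitt_act (V w - rpath w p) (fun=> 1) = 0.
  rewrite leavitt_actD leavitt_actN leavitt_act_class.
  rewrite (leavitt_act_rpath (fun=> 1)) // sp.
  by apply/funext => x; rewrite !fctE subrr.
move=> act0; have := leavitt_act_class (LVertex K w).
rewrite -/(V w) wE => /(congr1 (fun F => F (fun=> 1) (w, 0%N, 0))) /=.
rewrite leavitt_actM act0 /leavitt_act lact0 eqxx => /esym/eqP.
by rewrite oner_eq0.
Qed.

Lemma minimal_acyclic u w p q : minimal_left_ideal (left_mult (V u)) ->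
  walk w q -> start w q = u -> p != [::] -> walk w p -> start w p = w ->
  no_exits p -> False.
Proof.
move=> umin wq su p0 wp sp ne.
pose x := V u - rpath w q ** rpath w p ** gpath w q.
have ux : V u ** x = x.
  by rewrite numulDr numulNr !numulA lpa_vertexM lpa_vertex_rpath su !eqxx.
have xu : x ** V u = x.
  by rewrite numulDl numulNl -numulA lpa_vertexM gpath_lpa_vertex su !eqxx.
have xq : x ** rpath w q = rpath w q ** (V w - rpath w p).
  rewrite numulDl numulNl numulDr numulNr lpa_vertex_rpath su eqxx -!numulA.
  by rewrite gpath_rpath // !rpath_lpa_vertex.
(* Conjugation by [q] moves the problem from [u] to [w], where [x] becomes [w - p]. *)
have qxq : gpath w q ** (x ** rpath w q) = V w - rpath w p.
  rewrite xq numulA gpath_rpath // numulDr numulNr lpa_vertexM eqxx.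
  by rewrite lpa_vertex_rpath sp eqxx.
have x0 : x != 0.
  apply: contraNneq (closed_path_neq p0 ne wp) => x0.
  by rewrite -qxq x0 numul0l numul0r eqxx.
have [a ua] : exists a, V u = a ** x.
  by apply: minimal_generator => //; [exists x|rewrite ux].
(* From [u = a x] follows [w = q* u q = q* a x q = (q* a q)(w - p)]. *)
apply: (closed_path_not_inv (b := gpath w q ** a ** rpath w q) ne wp sp).
rewrite -!numulA -xq [a ** _]numulA -ua lpa_vertex_rpath su eqxx.
by rewrite gpath_rpath.
Qed.

Lemma minimal_no_bifurcation u w p e f : minimal_left_ideal (left_mult (V u)) ->
  walk w p -> start w p = u -> src e = w -> src f = w -> e = f.
Proof.
move=> umin wp su ew fw; apply/eqP/negPn/negP => ef.
have edge_path e' : src e' = w ->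
    rpath (rng e') (p ++ [:: e']) ** gpath (rng e') (p ++ [:: e']) = V u.
  move=> e'w; apply: minimal_path => //.
    by rewrite walk_cat [start _ [:: e']]e'w wp /= eqxx.
  by rewrite start_cat [start _ [:: e']]e'w.
have /eqP := lpa_vertex_neq0 u; apply.
have <- : V u ** V u = V u by rewrite lpa_vertexM eqxx.
(* Each factor of [u u] is expanded along a different edge; the product then contains [e* q f] with
   [q = p* p = w], that is [e* f = 0]. *)
rewrite -{1}(edge_path e) // -(edge_path f) //.
rewrite !rpath_cat !gpath_cat [start _ [:: e]]ew [start _ [:: f]]fw.
rewrite -!numulA [gpath w p ** (rpath w p ** _)]numulA gpath_rpath //.
rewrite [V w ** _]numulA lpa_vertex_edge fw eqxx.
rewrite [lpa_ghost K e ** (_ ** _)]numulA lpa_ghost_edge (negPf ef).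
by rewrite numul0l !numul0r.
Qed.

(** * The two implications *)

Lemma line_points_minimal u : line_points E u -> minimal_left_ideal (left_mult (V u)).
Proof.
move=> lu; split; first exact: left_mult_ideal.
  move=> u0; have := left_mult_vertex u; rewrite u0 => /= /eqP.
  by rewrite (negPf (lpa_vertex_neq0 u)).
move=> J Jid Ju; have [J0|/existsNP[x /not_implyP[Jx /eqP x0]]] :=
  pselect (forall x, J x -> x = 0).
  by left; apply/seteqP; split=> [x /J0//|_ ->]; case: Jid.
right; apply/seteqP; split=> //; apply: left_mult_sub => //.
have [a <-] := line_point_generator lu x0 (Ju x Jx).
by case: Jid => _ _ _; apply.
Qed.

Lemma minimal_line_points u : minimal_left_ideal (left_mult (V u)) -> line_points E u.
Proof.
move=> umin w /reachableP[q wq su].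
split.
  move=> /bifurcationP[e [f [ew fw /eqP]]]; apply.
  exact: minimal_no_bifurcation umin wq su ew fw.
move=> /cycle_atP[p [p0 wp sp]]; apply: (minimal_acyclic umin wq su p0 wp sp).
(* The closed path has no exits: following [q] and then its part [p1] before [e] leads from [u] to
   [src e], where a second edge would be a bifurcation. *)
move=> e f ep ef; have [p1 [p2 pE]] : exists p1 p2, p = p1 ++ e :: p2.
  by case/splitPr: ep => p1 p2; exists p1, p2.
have wep : walk w (e :: p2) by move: wp; rewrite pE walk_cat => /andP[].
have wp1 : walk (src e) p1 by move: wp; rewrite pE walk_cat => /andP[].
apply: (minimal_no_bifurcation (w := src e) (p := q ++ p1) umin) => //.
  rewrite walk_cat wp1 andbT; move: sp.
  by rewrite pE start_cat [start w (e :: p2)]/(src e) => ->.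
by rewrite start_cat -su; move: sp; rewrite pE start_cat => ->.
Qed.

End MinimalIdeals.

Theorem theorem4p12 (K : fieldType) (E : graph) (u : vertex E) :
  minimal_left_ideal (left_mult (lpa_vertex K u)) <-> line_points E u.
Proof. by split; [exact: minimal_line_points|exact: line_points_minimal]. Qed.
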